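(* Let $G$ be a graph on $n\ge 2$ vertices with $m\ge 1$ edges and let $M_2 = 4I + B$, where $B$ is the adjacency matrix of the line graph of $G$. The problem of minimizing $\mathbf{w}^\top M_2 \mathbf{w}$ over $\mathbf{w}\in\mathbb{R}^{m}$ subject to $\mathbf{1}^\top\mathbf{w} = m$ attains its minimum at $$\mathbf{w} = kM_2^{-1}\mathbf{1}\quad\text{with}\quad k = \frac{m}{\mathbf{1}^\top M_2^{-1}\mathbf{1}},$$ and the minimum value is $$\mathbf{w}^\top M_2\mathbf{w} = \frac{m^2}{\mathbf{1}^\top M_2^{-1}\mathbf{1}}.$$ Therefore $$\operatorname{mv}(G) \geq \frac{m^2}{(n-1)\,\mathbf{1}^\top M_2^{-1}\mathbf{1}} - \left(\frac{2m}{n-1}\right)^2,$$ and equality holds if $M_2^{-1}\mathbf{1}$ is entrywise nonnegative.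
   Context: Graphs are finite and simple. For a graph $G$ on $n$ vertices, $\mathcal{S}_L(G)$ denotes the set of $n\times n$ real symmetric matrices $A=[a_{i,j}]$ such that $a_{i,j}<0$ if $\{i,j\}\in E(G)$, $a_{i,j}=0$ if $i\neq j$ and $\{i,j\}\notin E(G)$, and $a_{i,i}=-\sum_{k\neq i}a_{i,k}$ for all $i$. Let $\mathcal{S}^s_L(G)=\{A\in\mathcal{S}_L(G):\operatorname{tr}(A)=2|E(G)|\}$. For $A\in\mathcal{S}_L(G)$ with spectrum $\{0,\lambda_2,\ldots,\lambda_n\}$ put $\mathbb{E}(A)=\frac{1}{n-1}\sum_{i=2}^n\lambda_i$ and $\operatorname{Var}(A)=\frac{1}{n-1}\sum_{i=2}^n(\lambda_i-\mathbb{E}(A))^2$. The minimum variance of $G$ is $\operatorname{mv}(G)=\inf\{\operatorname{Var}(A):A\in\mathcal{S}^s_L(G)\}$. The line graph of $G$ has vertex set $E(G)$, two distinct edges being adjacent when they share a vertex. $\mathbf{1}$ is the all-ones vector. The matrix $M_2$ is positive definite, hence invertible. *)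

(* Defs.v *)
From HB Require Import structures.
From mathcomp Require Import all_boot all_order all_algebra.
From mathcomp Require Import complex.

Set Implicit Arguments.
Unset Strict Implicit.
Unset Printing Implicit Defensive.

Import Order.TTheory GRing.Theory Num.Theory.
Local Open Scope ring_scope.

Record sgraph (n : nat) := SGraph {
  adj : rel 'I_n;
  adj_sym : symmetric adj;
  adj_irr : irreflexive adj
}.

Definition edges n (G : sgraph n) : {set {set 'I_n}} :=
  [set f : {set 'I_n} | [exists x, exists y, adj G x y && (f == [set x; y])]].

Definition edge n (G : sgraph n) (i : 'I_#|edges G|) : {set 'I_n} := enum_val i.

Definition line_adj n (G : sgraph n) : rel 'I_#|edges G| :=
  [rel i j | (i != j) && (edge i :&: edge j != set0)].

Lemma line_adj_sym n (G : sgraph n) : symmetric (@line_adj n G).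
Proof. by move=> i j; rewrite /line_adj /= eq_sym setIC. Qed.

Lemma line_adj_irr n (G : sgraph n) : irreflexive (@line_adj n G).
Proof. by move=> i; rewrite /line_adj /= eqxx. Qed.

Definition line_graph n (G : sgraph n) : sgraph #|edges G| :=
  SGraph (@line_adj_sym n G) (@line_adj_irr n G).

Definition adjmx (R : pzRingType) n (G : sgraph n) : 'M[R]_n :=
  \matrix_(i, j) (adj G i j)%:R.

Definition ones (R : pzRingType) n : 'cV[R]_n := const_mx 1.

Definition M2 (R : pzRingType) n (G : sgraph n) : 'M[R]_#|edges G| :=
  4%:M + adjmx R (line_graph G).

Lemma card_edge n (G : sgraph n) (i : 'I_#|edges G|) : #|edge i| = 2%N.
Proof.
have := enum_valP i; rewrite inE -/(edge i).
case/existsP=> x /existsP[y /andP[xy /eqP ->]]; rewrite cards2.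
by case: eqVneq xy => // ->; rewrite adj_irr.
Qed.

Lemma card_edgeI n (G : sgraph n) (i j : 'I_#|edges G|) :
  #|edge i :&: edge j| = ((i == j).*2 + line_adj i j)%N.
Proof.
rewrite /line_adj /=; case: eqVneq => [->|ij] /=; first by rewrite setIid card_edge.
case: eqVneq => [->|ne]; first by rewrite cards0.
apply/eqP; rewrite eqn_leq card_gt0 ne andbT -ltnS -[2%N in X in (_ < X)%N](card_edge i).
rewrite ltn_neqAle subset_leq_card ?subsetIl // andbT; apply: contra ij => /eqP c.
have/eqP e : edge i :&: edge j == edge i by rewrite eqEcard subsetIl c leqnn.
apply/eqP/enum_val_inj; apply/eqP; rewrite eqEcard !card_edge leqnn andbT.
by rewrite -/(edge i) -/(edge j) -e subsetIr.
Qed.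

Definition incmx (R : pzRingType) n (G : sgraph n) : 'M[R]_(n, #|edges G|) :=
  \matrix_(v, i) (v \in edge i)%:R.

Lemma M2_incmx (R : comPzRingType) n (G : sgraph n) :
  M2 R G = 2%:M + (incmx R G)^T *m incmx R G.
Proof.
apply/matrixP=> i j; rewrite !mxE.
transitivity (2%:R *+ (i == j) + (#|edge i :&: edge j|)%:R : R).
  rewrite card_edgeI natrD addrA; congr (_ + _).
  by case: (i == j); rewrite ?add0r // -natrD.
congr (_ + _); rewrite -sum1_card natr_sum big_mkcond /=.
by apply: eq_bigr => v _; rewrite !mxE inE; do 2!case: (v \in _);
  rewrite ?mulr1 ?mulr0.
Qed.

Lemma M2_posdef (R : realFieldType) n (G : sgraph n) (w : 'cV[R]_#|edges G|) :
  w != 0 -> 0 < (w^T *m M2 R G *m w) 0 0.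
Proof.
have sq k (x : 'cV[R]_k) : (x^T *m x) 0 0 = \sum_i x i 0 ^+ 2.
  by rewrite mxE; apply: eq_bigr => i _; rewrite mxE.
move=> w0; rewrite M2_incmx mulmxDr mulmxDl mxE ltr_wpDr //.
  rewrite mulmxA -mulmxA -trmx_mul sq; apply: sumr_ge0 => i _; exact: sqr_ge0.
rewrite mul_mx_scalar -scalemxAl mxE sq mulr_gt0 // lt_def.
rewrite sumr_ge0 ?andbT => [|i _]; last exact: sqr_ge0.
apply: contra w0 => /eqP/psumr_eq0P z; apply/eqP/matrixP=> i j; rewrite ord1 mxE.
by apply/eqP; rewrite -sqrf_eq0 z // => k _; exact: sqr_ge0.
Qed.

Lemma M2_unitmx (R : realFieldType) n (G : sgraph n) : M2 R G \in unitmx.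
Proof.
rewrite -row_free_unit -kermx_eq0; apply/rowV0P => v /sub_kermxP vM.
apply/eqP; apply: contraT => v0.
have := @M2_posdef R n G v^T; rewrite trmx_eq0 trmxK vM mul0mx mxE ltxx.
by move=> /(_ v0).
Qed.

Lemma symmetric_split (R : rcfType) n (A : 'M[R]_n) : A^T = A ->
  exists s : seq R, char_poly A = \prod_(x <- s) ('X - x%:P).
Proof.
move=> Asym; pose f := real_complex R; pose B := map_mx f A.
have Breal : B \is a mxOver Num.real.
  by apply/mxOverP => i j; rewrite mxE; apply/complex_realP; exists (A i j).
have Bherm : B \is hermitianmx _ false Num.conj.
  apply: realsym_hermsym => //; apply/is_hermitianmxP.
  by rewrite expr0 scale1r map_mx_id // map_trmx Asym.
have /orthomx_spectralP defB := hermitian_normalmx Bherm.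
have Dreal := hermitian_spectral_diag_real Bherm.
set P := spectralmx B in defB; set D := spectral_diag B in defB Dreal.
exists [seq complex.Re (D 0 i) | i <- enum 'I_n].
apply: (map_poly_inj f); rewrite map_char_poly -/B.
have Pu : P \in unitmx := spectral_unit B.
have -> : char_poly B = char_poly (diag_mx D).
  pose Q := map_mx polyC P; have Qu : Q \in unitmx by rewrite map_unitmx.
  rewrite /char_poly; suff -> : char_poly_mx B =
      invmx Q *m char_poly_mx (diag_mx D) *m Q.
    by rewrite !det_mulmx mulrAC -det_mulmx mulVmx // det1 mul1r.
  rewrite /char_poly_mx mulmxBr mulmxBl mul_mx_scalar -scalemxAl mulVmx //.
  by rewrite scalemx1 {1}defB !map_mxM map_invmx.
rewrite char_poly_trig; last first.
  by apply/is_trig_mxP=> i j; rewrite mxE ltn_neqAle => /andP[/negPf ne _];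
    rewrite -val_eqE /= ne mulr0n.
rewrite big_map rmorph_prod /= -big_enum /=; apply: eq_bigr => i _.
rewrite mxE eqxx mulr1n rmorphB /= map_polyX map_polyC /= RRe_real //.
exact: (mxOverP Dreal).
Qed.

From mathcomp Require Import classical_sets reals.

Local Open Scope classical_set_scope.

Definition SL (R : realType) n (G : sgraph n) : set 'M[R]_n :=
  [set A | [/\ A^T = A,
    (forall i j, adj G i j -> A i j < 0),
    (forall i j, i != j -> ~~ adj G i j -> A i j = 0) &
    (forall i, A i i = - \sum_(k | k != i) A i k)]].

Definition SLs (R : realType) n (G : sgraph n) : set 'M[R]_n :=
  [set A | SL G A /\ \tr A = (2 * #|edges G|)%:R].

(* The eigenvalues with multiplicity, in some order.  Such a list exists for
   every symmetric matrix (spectrumP); when the characteristic polynomial does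
   not split over R, the value is the junk [::].  *)
Definition spectrum (R : realType) n (A : 'M[R]_n) : seq R :=
  xget [::] [set s | char_poly A = \prod_(x <- s) ('X - x%:P)].

Lemma spectrumP (R : realType) n (A : 'M[R]_n) : A^T = A ->
  char_poly A = \prod_(x <- spectrum A) ('X - x%:P).
Proof.
move=> /symmetric_split sp; exact: (@xgetPex (seq R) [::] [set s | _] sp).
Qed.

(* One copy of 0, the eigenvalue of the all-ones vector, is dropped: for
   A in SL G this lists lambda_2, ..., lambda_n.  *)
Definition spectrum' (R : realType) n (A : 'M[R]_n) : seq R :=
  rem 0 (spectrum A).

Lemma SL_spectrum0 (R : realType) n (G : sgraph n) (A : 'M[R]_n) :
  (0 < n)%N -> SL G A -> 0 \in spectrum A.
Proof.
case: n G A => // n G A _ [symA _ _ dA].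
rewrite -root_prod_XsubC -spectrumP // -eigenvalue_root_char.
apply/eigenvalueP; exists (const_mx 1).
  rewrite scale0r -[A]symA; apply/matrixP=> i j; rewrite !mxE.
  rewrite (bigD1 j) //= !mxE mul1r dA -[RHS](addNr (\sum_(k | k != j) A j k)).
  by congr (_ + _); apply: eq_bigr => k _; rewrite !mxE mul1r.
by apply/eqP=> /matrixP/(_ 0 0)/eqP; rewrite !mxE oner_eq0.
Qed.

Definition mean (R : realType) n (A : 'M[R]_n) : R :=
  (n%:R - 1)^-1 * \sum_(x <- spectrum' A) x.

Definition Var (R : realType) n (A : 'M[R]_n) : R :=
  (n%:R - 1)^-1 * \sum_(x <- spectrum' A) (x - mean A) ^+ 2.

Definition mv (R : realType) n (G : sgraph n) : R :=
  inf [set Var A | A in @SLs R n G].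

(* Main.v *)
Require Import Defs.
From mathcomp Require Import all_boot all_order all_algebra.
From mathcomp Require Import classical_sets reals.
From mathcomp Require Import ring lra.

Import Order.TTheory GRing.Theory Num.Theory.
Local Open Scope ring_scope.

(** A matrix in S_L(G) is determined by the weights w_e = - a_ij on its edges
e = {i, j}, and every vector of positive weights arises.  So the problem
can be rewritten in terms of w.

- Since 0 is an eigenvalue, the sums of the lambda_i and of their squares over
  i >= 2 are tr A and tr A^2; hence Var A is tr A^2 / (n - 1) minus the square
  of tr A / (n - 1) ([Var_moments]).  The trace of A^2 is read off from
  det(X^2 - A^2) = det(X - A) det(X + A) ([split_char_poly_sqr]).
- The trace of A is twice the sum of the weights ([lapmx_trace]), so the
  normalization tr A = 2m says 1^T w = m.
- Changing the signs of off-diagonal entries does not affect tr A^2, so A may be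
  replaced by the signless N D N^T, where N is the vertex-edge incidence matrix
  and D = diag(w).  By cyclicity of the trace, tr A^2 is the sum of
  w_e w_f (N^T N)_ef^2.  Two edges meet in 2, 1 or 0 vertices, and the squares
  4, 1, 0 are precisely the entries of M_2, so tr A^2 = w^T M_2 w
  ([lapmx_sqr_trace]).

On the hyperplane 1^T w = m, the point w0 = k M_2^-1 1 satisfies
M_2 w0 = k 1.  The cross terms in w0 + d therefore vanish whenever 1^T d = 0
([quad_orthogonal]), and positive definiteness makes w0 the minimizer.  Every A in
the feasible set gives such a w, so the minimum bounds mv(G) from below.

When M_2^-1 1 has nonnegative entries, w0 may still have zero entries, and then
the infimum need not be attained.  The segment w0 + t (1 - w0), for
0 < t <= 1, consists of feasible positive weights; the variance along it is the
bound plus a constant times t^2, so the bound is approached as t tends to 0. *)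

(** * Spectral moments of a symmetric matrix *)

Lemma split_char_poly_size {R : comNzRingType} {n} {A : 'M[R]_n} {s : seq R} :
  char_poly A = \prod_(x <- s) ('X - x%:P) -> size s = n.
Proof.
by move=> e; apply: succn_inj; rewrite -(size_char_poly A) e size_prod_XsubC.
Qed.

Lemma split_char_poly_trace {R : comNzRingType} {n} {A : 'M[R]_n} {s : seq R} :
  char_poly A = \prod_(x <- s) ('X - x%:P) -> \tr A = \sum_(x <- s) x.
Proof.
move=> e; have sz := split_char_poly_size e.
case: n A e sz => [|n] A e sz.
  by rewrite (size0nil sz) big_nil /mxtrace big_ord0.
apply: oppr_inj; rewrite -char_poly_trace // e -[n.+1.-1]/(n.+1).-1 -sz.
by rewrite coefPn_prod_XsubC ?sz.
Qed.

(** Substituting X^2 for X in the characteristic polynomial of A^2 gives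
det(X^2 - A^2) = det(X - A) det(X + A), and the second factor is, up to sign,
the characteristic polynomial of A at -X.  Composition with X^2 is injective,
so the eigenvalues of A^2 are found without diagonalizing A. *)
Lemma split_char_poly_sqr {R : idomainType} {n} {A : 'M[R]_n} {s : seq R} :
  char_poly A = \prod_(x <- s) ('X - x%:P) ->
  char_poly (A *m A) = \prod_(x <- [seq y ^+ 2 | y <- s]) ('X - x%:P).
Proof.
move=> e; have sz := split_char_poly_size e.
apply/eqP; rewrite -subr_eq0 -(comp_poly_eq0 _ (q := 'X^2)) ?size_polyXn //.
rewrite comp_polyB subr_eq0; apply/eqP.
(* Over {poly R}, evaluating det(X - B) at q gives det(q - B). *)
have compM (q : {poly R}) (B : 'M[R]_n) :
    map_mx (comp_poly q) (char_poly_mx B) = q%:M - map_mx polyC B.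
  apply/matrixP=> i j; rewrite !mxE comp_polyB comp_polyC.
  by case: (i == j); rewrite ?mulr1n ?mulr0n ?comp_polyX ?comp_poly0.
have compD (q : {poly R}) (B : 'M[R]_n) :
    char_poly B \Po q = \det (q%:M - map_mx polyC B).
  by rewrite -compM det_map_mx.
rewrite compD map_mxM /=; set C := map_mx polyC A.
have -> : ('X^2)%:M - C *m C = ('X%:M - C) *m (-1 *: ((- 'X)%:M - C)).
  rewrite [(- 'X)%:M]raddfN scaleN1r opprB opprK mulmxBl !mulmxDr.
  rewrite -scalar_mxM -expr2 mul_scalar_mx mul_mx_scalar opprD.
  by rewrite [- (_ *m _) + _]addrC addrACA subrr add0r.
rewrite det_mulmx detZ -!compD e -[X in _ ^+ X]sz !rmorph_prod big_map /=.
(* The sign (-1)^n is spread over the n factors -X - x. *)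
have -> : (-1) ^+ size s = \prod_(x <- s) (-1) :> {poly R}.
  by rewrite big_const_seq count_predT iter_mulr_1.
rewrite -!big_split; apply: eq_bigr => x _ /=.
rewrite !comp_polyB !comp_polyC !comp_polyX rmorphXn /=; ring.
Qed.

(** * Weighted Laplacians *)

(** Off the diagonal at most one edge contributes; the diagonal entry at i sums
the weights of the edges at i.  Apart from the sign this is the signless
Laplacian N diag(w) N^T, with N the incidence matrix.  The uniform formula makes the comparison of the two in
[lapmx_sqr_trace] immediate. *)
Definition lapmx {R : pzRingType} {n} (G : sgraph n) (w : 'cV[R]_#|edges G|) :
    'M[R]_n :=
  \matrix_(i, j) ((-1) ^+ (i != j) *
     \sum_e w e 0 * ((i \in edge e) && (j \in edge e))%:R).

Lemma edge_of_adj {n} (G : sgraph n) x y :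
  adj G x y -> exists e : 'I_#|edges G|, edge e = [set x; y].
Proof.
move=> xy; have f : [set x; y] \in edges G.
  by rewrite inE; apply/existsP; exists x; apply/existsP; exists y; rewrite xy /=.
by exists (enum_rank_in f [set x; y]); rewrite /edge enum_rankK_in.
Qed.

Lemma edge_ends {n} {G : sgraph n} (e : 'I_#|edges G|) :
  exists x y, adj G x y /\ edge e = [set x; y].
Proof.
have := enum_valP e; rewrite inE -/(edge e).
by case/existsP=> x /existsP[y /andP[xy /eqP ->]]; exists x, y.
Qed.

Lemma mem2_edge {n} {G : sgraph n} (e : 'I_#|edges G|) i j : i != j ->
  (i \in edge e) && (j \in edge e) = (edge e == [set i; j]).
Proof.
move=> ij; rewrite eq_sym eqEcard card_edge cards2 ij leqnn andbT.
by rewrite finset.subUset !finset.sub1set.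
Qed.

Lemma set2_eq {T : finType} (x y i j : T) :
  [set x; y] = [set i; j] -> (i = x /\ j = y) \/ (i = y /\ j = x).
Proof.
move=> e; have : x \in [set i; j]%SET by rewrite -e set21.
have : y \in [set i; j]%SET by rewrite -e set22.
have : i \in [set x; y]%SET by rewrite e set21.
have : j \in [set x; y]%SET by rewrite e set22.
by rewrite !inE; do 4!case/orP=> /eqP ?; subst; auto.
Qed.

Lemma adj_of_edge {n} {G : sgraph n} (e : 'I_#|edges G|) i j :
  edge e = [set i; j] -> adj G i j.
Proof.
have [x [y [xy ->]]] := edge_ends e.
by move=> /set2_eq[] [-> ->] //; rewrite adj_sym.
Qed.

Lemma sum_mem {R : pzSemiRingType} {T : finType} (A : {set T}) :
  \sum_x (x \in A)%:R = #|A|%:R :> R.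
Proof.
rewrite -sum1_card natr_sum [RHS]big_mkcond /=.
by apply: eq_bigr => x _; case: (x \in A).
Qed.

Lemma lapmx_edge {R : pzRingType} {n} {G : sgraph n} (w : 'cV[R]_#|edges G|)
    (e : 'I_#|edges G|) i j :
  i != j -> edge e = [set i; j] -> lapmx G w i j = - w e 0.
Proof.
move=> ij ee; rewrite mxE ij expr1 mulN1r (bigD1 e) //= mem2_edge // ee eqxx.
rewrite mulr1 big1 ?addr0 // => f fe; rewrite mem2_edge // -ee.
by rewrite (inj_eq enum_val_inj) (negPf fe) mulr0.
Qed.

Lemma lapmx_nonadj {R : pzRingType} {n} {G : sgraph n}
    (w : 'cV[R]_#|edges G|) i j :
  i != j -> ~~ adj G i j -> lapmx G w i j = 0.
Proof.
move=> ij nij; rewrite mxE big1 ?mulr0 // => f _; rewrite mem2_edge //.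
case: eqP => [fij|_]; last by rewrite mulr0.
by rewrite (adj_of_edge _ _ _ fij) in nij.
Qed.

(** After exchanging the sums, each edge at i is counted once, for its other
end. *)
Lemma lapmx_diag {R : pzRingType} {n} (G : sgraph n) (w : 'cV[R]_#|edges G|) i :
  lapmx G w i i = - \sum_(k | k != i) lapmx G w i k.
Proof.
rewrite mxE eqxx mul1r -sumrN.
rewrite [RHS](eq_bigr (fun k => \sum_e w e 0 *
    ((i \in edge e) && (k \in edge e))%:R)); last first.
  by move=> k ki; rewrite mxE eq_sym ki expr1 mulN1r opprK.
rewrite exchange_big; apply: eq_bigr => e _; rewrite -mulr_sumr; congr (_ * _).
rewrite andbb; case: (boolP (i \in edge e)) => [ie|_] /=; last by rewrite big1.
have := card_edge e; rewrite (cardsD1 i) ie => -[c].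
rewrite -[1%N]c -sum_mem [RHS]big_mkcond; apply: eq_bigr => k _.
by rewrite !inE; case: (k != i).
Qed.

Lemma lapmx_sym {R : pzRingType} {n} (G : sgraph n) (w : 'cV[R]_#|edges G|) :
  (lapmx G w)^T = lapmx G w.
Proof.
apply/matrixP=> i j; rewrite !mxE eq_sym; congr (_ * _).
by apply: eq_bigr => e _; rewrite andbC.
Qed.

Lemma lapmx_trace {R : comPzRingType} {n} (G : sgraph n) (w : 'cV[R]_#|edges G|) :
  \tr (lapmx G w) = 2 * ((ones R #|edges G|)^T *m w) 0 0.
Proof.
rewrite mxE mulr_sumr /mxtrace.
rewrite (eq_bigr (fun i => \sum_e w e 0 * (i \in edge e)%:R)); last first.
  move=> i _; rewrite mxE eqxx mul1r.
  by apply: eq_bigr => e _; rewrite andbb.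
rewrite exchange_big; apply: eq_bigr => e _; rewrite !mxE mul1r -mulr_sumr mulrC.
by rewrite sum_mem card_edge.
Qed.

(** Distinct edges share at most one vertex, so squaring the entries of the Gram
matrix N^T N of the incidence matrix only turns its diagonal 2 into 4. *)
Lemma M2_card (R : pzRingType) {n} (G : sgraph n) e f :
  M2 R G e f = (#|edge e :&: edge f| ^ 2)%:R.
Proof.
rewrite !mxE /= card_edgeI /line_adj /=.
by case: eqVneq => _; rewrite ?addr0 //= mulr0n add0r; case: (_ != _).
Qed.

(** The squared Frobenius norm ignores the signs of the entries, so it can be
computed on Q = N diag(w) N^T; cyclicity of the trace then moves everything to
the edges, where the entrywise square of N^T N appears. *)
Lemma lapmx_sqr_trace {R : comPzRingType} {n} (G : sgraph n)
    (w : 'cV[R]_#|edges G|) :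
  \tr (lapmx G w *m lapmx G w) = (w^T *m M2 R G *m w) 0 0.
Proof.
set N := incmx R G; pose Q := N *m diag_mx w^T *m N^T.
have QE i j : lapmx G w i j = (-1) ^+ (i != j) * Q i j.
  rewrite !mxE; congr (_ * _); apply: eq_bigr => e _.
  rewrite mul_mx_diag !mxE mulrAC mulrC; congr (_ * _).
  by rewrite -mulnb natrM.
have -> : \tr (lapmx G w *m lapmx G w) = \tr (Q *m Q).
  apply: eq_bigr => i _; rewrite !mxE; apply: eq_bigr => j _.
  by rewrite !QE eq_sym mulrACA -expr2 sqrr_sign mul1r.
have -> : \tr (Q *m Q) = \tr ((diag_mx w^T *m (N^T *m N)) *m
                              (diag_mx w^T *m (N^T *m N))).
  by rewrite /Q -!mulmxA mxtrace_mulC !mulmxA.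
have NN e f : (N^T *m N) e f = (#|edge e :&: edge f|)%:R.
  rewrite mxE -sum_mem; apply: eq_bigr => v _.
  by rewrite !mxE inE -mulnb natrM.
rewrite mxE; under [RHS]eq_bigr => f _ do rewrite mxE mulr_suml.
rewrite exchange_big /=; apply: eq_bigr => e _; rewrite mxE; apply: eq_bigr => f _.
rewrite !mul_diag_mx M2_card natrX; move: (N^T *m N) NN => K KE.
by rewrite !mxE !KE [edge f :&: _]finset.setIC; ring.
Qed.

Lemma SL_lapmx {R : realType} {n} (G : sgraph n) (w : 'cV[R]_#|edges G|) :
  (forall e, 0 < w e 0) -> SL G (lapmx G w).
Proof.
move=> w0; split; first exact: lapmx_sym.
- move=> i j ij; have [e ee] := edge_of_adj _ _ _ ij.
  rewrite (lapmx_edge _ e) ?oppr_lt0 //.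
  by apply: contraTneq ij => ->; rewrite adj_irr.
- exact: lapmx_nonadj.
- exact: lapmx_diag.
Qed.

(** The weight of an edge is minus the entry at its ends, which by symmetry does
not depend on their order; the zero row sums then force the diagonal. *)
Lemma SL_is_lapmx {R : realType} {n} (G : sgraph n) (A : 'M[R]_n) :
  SL G A -> exists w, A = lapmx G w.
Proof.
move=> [sA _ nadjA dA].
have wt (e : 'I_#|edges G|) :
    exists c, forall i j, edge e = [set i; j] -> A i j = - c.
  have [x [y [_ ->]]] := edge_ends e; exists (- A x y) => i j.
  by move=> /set2_eq[] [-> ->]; rewrite opprK // -{1}sA mxE.
have [c cP] := fin_all_exists wt.
pose w : 'cV_#|edges G| := \col_e c e; exists w.
have offdiag i j : i != j -> A i j = lapmx G w i j.
  move=> ij; have [/edge_of_adj[e ee]|nij] := boolP (adj G i j).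
    by rewrite (lapmx_edge _ e) // mxE; apply: cP.
  by rewrite lapmx_nonadj // nadjA.
apply/matrixP=> i j; have [<-|ij] := eqVneq i j; last exact: offdiag.
rewrite dA lapmx_diag; congr (- _); apply: eq_bigr => k ki.
by apply: offdiag; rewrite eq_sym.
Qed.

(** * The variance as a quadratic form *)

(** Dropping one eigenvalue 0 from the spectrum changes neither power sum, and
leaves n - 1 values for the usual formula: mean of the squares minus square of
the mean. *)
Lemma Var_moments {R : realType} {n} (G : sgraph n) (A : 'M[R]_n) :
  (2 <= n)%N -> SL G A ->
  Var A = \tr (A *m A) / (n%:R - 1) - (\tr A / (n%:R - 1)) ^+ 2.
Proof.
move=> n2 GA; have [sA _ _ _] := GA.
have chiA := spectrumP sA.
have s0 := SL_spectrum0 (ltnW n2) GA.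
have tr1 : \tr A = \sum_(x <- spectrum' A) x.
  by rewrite (split_char_poly_trace chiA) (big_rem _ s0) /= add0r.
have tr2 : \tr (A *m A) = \sum_(x <- spectrum' A) x ^+ 2.
  rewrite (split_char_poly_trace (split_char_poly_sqr chiA)) big_map.
  by rewrite (big_rem _ s0) /= expr0n add0r.
have sz : (size (spectrum' A))%:R = n%:R - 1 :> R.
  rewrite size_rem // (split_char_poly_size chiA) -subn1 natrB //.
  exact: ltnW.
have n1 : n%:R - 1 != 0 :> R.
  by rewrite -sz pnatr_eq0 size_rem // (split_char_poly_size chiA) -lt0n ltn_predRL.
have muE : mean A = \tr A / (n%:R - 1) by rewrite /mean -tr1 mulrC.
rewrite /Var.
under eq_bigr do rewrite sqrrB.
rewrite !big_split /= -tr2 sumrN sumrMnl -mulr_suml -tr1.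
rewrite big_const_seq count_predT iter_addr_0 -[_ *+ size _]mulr_natr sz muE.
by field.
Qed.

Lemma Var_lapmx {R : realType} {n} (G : sgraph n) (w : 'cV[R]_#|edges G|) :
  (2 <= n)%N -> SLs G (lapmx G w) ->
  Var (lapmx G w) = (w^T *m M2 R G *m w) 0 0 / (n%:R - 1)
                    - (2 * #|edges G|%:R / (n%:R - 1)) ^+ 2.
Proof.
by move=> n2 [GA trA]; rewrite (Var_moments G) // lapmx_sqr_trace trA natrM.
Qed.

(** * Minimizing a quadratic form on an affine hyperplane *)

(** Every direction d with b^T d = 0 is orthogonal to u for the form M, because
M u = b; so the form splits along u and d as in Pythagoras' theorem. *)
Lemma quad_orthogonal {R : comPzRingType} {m} (M : 'M[R]_m) (u b d : 'cV[R]_m) (a : R) :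
  M^T = M -> M *m u = b -> b^T *m d = 0 ->
  ((a *: u + d)^T *m M *m (a *: u + d)) 0 0 =
    a ^+ 2 * (b^T *m u) 0 0 + (d^T *m M *m d) 0 0.
Proof.
move=> sM Mu bd.
have uM : u^T *m M = b^T by rewrite -Mu trmx_mul sM.
have db : d^T *m b = 0 by rewrite -[LHS]trmxK trmx_mul trmxK bd trmx0.
rewrite [(_ + _)^T]linearP /= mulmxDl -scalemxAl uM mulmxDr !mulmxDl.
rewrite -!scalemxAr -!scalemxAl bd.
rewrite -[d^T *m M *m u]mulmxA Mu db !scaler0 addr0 add0r scalerA -expr2.
by rewrite !mxE.
Qed.

(** * The minimum variance *)

Theorem proposition4p5 (R : realType) (n : nat) (G : sgraph n) :
  (2 <= n)%N -> (1 <= #|edges G|)%N ->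
  let m : nat := #|edges G| in
  let M : 'M[R]_m := M2 R G in
  let u : 'cV[R]_m := invmx M *m ones R m in
  let s : R := ((ones R m)^T *m invmx M *m ones R m) 0 0 in
  let k : R := m%:R / s in
  let w0 : 'cV[R]_m := k *: u in
  [/\ ((ones R m)^T *m w0) 0 0 = m%:R,
      (forall w : 'cV[R]_m, ((ones R m)^T *m w) 0 0 = m%:R ->
         (w0^T *m M *m w0) 0 0 <= (w^T *m M *m w) 0 0),
      (w0^T *m M *m w0) 0 0 = m%:R ^+ 2 / s,
      m%:R ^+ 2 / ((n%:R - 1) * s) - (2 * m%:R / (n%:R - 1)) ^+ 2
        <= mv R G &
      (forall i, 0 <= u i 0) ->
        mv R G =
        m%:R ^+ 2 / ((n%:R - 1) * s) - (2 * m%:R / (n%:R - 1)) ^+ 2].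
Proof.
move=> n2 m1 m M u s k w0.
have sM : M^T = M.
  by rewrite /M M2_incmx linearD /= tr_scalar_mx trmx_mul trmxK.
have Mu : M *m u = ones R m by rewrite mulmxA mulmxV ?mul1mx ?M2_unitmx.
have one_u : ((ones R m)^T *m u) 0 0 = s by rewrite mulmxA.
have q_ge0 (d : 'cV[R]_m) : 0 <= (d^T *m M *m d) 0 0.
  have [->|d0] := eqVneq d 0; first by rewrite mulmx0 mxE.
  exact/ltW/M2_posdef.
have s_gt0 : 0 < s.
  have u0 : u != 0.
    apply/eqP => u0; move: Mu; rewrite u0 mulmx0 => /matrixP/(_ (Ordinal m1) 0).
    by rewrite !mxE => /eqP; rewrite eq_sym oner_eq0.
  by have := M2_posdef u0; rewrite -[u^T *m _]trmxK trmx_mul sM trmxK Mu one_u.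
have sN0 : s != 0 by rewrite gt_eqF.
have n1_gt0 : 0 < n%:R - 1 :> R by rewrite subr_gt0 ltr1n.
have n1N0 : n%:R - 1 != 0 :> R by rewrite gt_eqF.
have one_w0 : ((ones R m)^T *m w0) 0 0 = m%:R.
  by rewrite -scalemxAr mxE one_u divfK.
have q_w0D (d : 'cV[R]_m) : ((ones R m)^T *m d) 0 0 = 0 ->
    ((w0 + d)^T *m M *m (w0 + d)) 0 0 = m%:R ^+ 2 / s + (d^T *m M *m d) 0 0.
  move=> d0; rewrite (quad_orthogonal M u (ones R m)) //; last first.
    by apply/matrixP=> i j; rewrite !ord1 d0 mxE.
  by rewrite one_u /k; congr (_ + _); field.
have q_w0 : (w0^T *m M *m w0) 0 0 = m%:R ^+ 2 / s.
  by have := q_w0D 0; rewrite !mulmx0 addr0 mxE addr0; apply.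
have one_sub (w : 'cV[R]_m) : ((ones R m)^T *m w) 0 0 = m%:R ->
    ((ones R m)^T *m (w - w0)) 0 0 = 0.
  by move=> w1; rewrite mulmxBr mxE [X in _ + X]mxE w1 one_w0 subrr.
have w0_min (w : 'cV[R]_m) : ((ones R m)^T *m w) 0 0 = m%:R ->
    (w0^T *m M *m w0) 0 0 <= (w^T *m M *m w) 0 0.
  move=> /one_sub /q_w0D; rewrite [w0 + _]addrC subrK => ->.
  by rewrite q_w0 lerDl.
set V0 := _ - _.
have V0E : V0 = (m%:R ^+ 2 / s) / (n%:R - 1) - (2 * m%:R / (n%:R - 1)) ^+ 2.
  by rewrite /V0; field; rewrite n1N0.
have lapmx_feasible (w : 'cV[R]_m) : (forall e, 0 < w e 0) ->
    ((ones R m)^T *m w) 0 0 = m%:R -> SLs G (lapmx G w).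
  move=> w_gt0 w1; split; first exact: SL_lapmx.
  by rewrite lapmx_trace w1 natrM.
have V0_lb : lbound [set Var A | A in @SLs R n G]%classic V0.
  move=> _ [A [GA trA] <-]; have [w Aw] := SL_is_lapmx G A GA.
  rewrite V0E Aw Var_lapmx -?Aw // lerD2r ler_pM2r ?invr_gt0 // -q_w0.
  have two_neq0 : 2 != 0 :> R by rewrite pnatr_eq0.
  apply: w0_min; apply: (mulfI two_neq0).
  by have := lapmx_trace G w; rewrite -Aw trA natrM => <-.
have one1 : ((ones R m)^T *m ones R m) 0 0 = m%:R.
  rewrite mxE (eq_bigr (fun _ => 1)) ?sumr_const ?card_ord // => i _.
  by rewrite !mxE mulr1.
have mv_ge : V0 <= mv R G.
  apply: lb_le_inf => //; exists (Var (lapmx G (ones R m))).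
  by exists (lapmx G (ones R m)) => //; apply: lapmx_feasible => // e; rewrite mxE.
split=> // u_ge0; apply/eqP; rewrite eq_le mv_ge andbT.
have k_gt0 : 0 < k by rewrite divr_gt0 // ltr0n.
set d := ones R m - w0; set c := (d^T *m M *m d) 0 0 / (n%:R - 1).
have c_ge0 : 0 <= c by rewrite divr_ge0 // ltW.
(* w0 may vanish on some edges; mixing in a little of the all-ones weights
   makes it feasible, at a cost quadratic in t. *)
have mv_le t : 0 < t <= 1 -> mv R G <= t ^+ 2 * c + V0.
  move=> /andP[t_gt0 t_le1]; pose w := w0 + t *: d.
  have d1 : ((ones R m)^T *m (t *: d)) 0 0 = 0.
    by rewrite -scalemxAr mxE one_sub // mulr0.
  have Vw : SLs G (lapmx G w).
    apply: lapmx_feasible; last by rewrite mulmxDr mxE one_w0 d1 addr0.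
    move=> e; have -> : w e 0 = (1 - t) * (k * u e 0) + t.
      by rewrite /w /d /w0; move: (u) => v; rewrite !mxE; ring.
    by rewrite ltr_wpDl // mulr_ge0 ?subr_ge0 // mulr_ge0 // ltW.
  have <- : Var (lapmx G w) = t ^+ 2 * c + V0.
    rewrite Var_lapmx // q_w0D // V0E /c [(t *: d)^T]linearZ /=.
    rewrite -!scalemxAl -scalemxAr.
    move: (d^T *m M *m d) => q; by rewrite !mxE; field; rewrite n1N0 sN0.
  by apply: ge_inf; [exists V0 | exists (lapmx G w)].
(* With t = eps / (eps + c + 1) <= 1, t^2 c <= t c <= eps. *)
apply/ler_addgt0Pl => eps eps_gt0.
have D_gt0 : 0 < eps + c + 1 by rewrite ltr_wpDr // ltr_wpDr.
set t := eps / (eps + c + 1).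
have t01 : 0 < t <= 1.
  by rewrite divr_gt0 // ler_pdivrMr // mul1r -addrA lerDl addr_ge0.
apply: (le_trans (mv_le t t01)); rewrite lerD2r.
have /andP[t_gt0 t_le1] := t01.
have : t * (eps + c + 1) = eps by rewrite divfK // gt_eqF.
nra.
Qed.
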